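(* Let $G$ be a connected simple graph on the vertex set $[n]$ with $G\neq \mathcal{K}_n$, let $K$ be a field, and let $J_G\subseteq S=K[x_1,\dots,x_n,y_1,\dots,y_n]$ be the binomial edge ideal of $G$. Then $$\mathrm{v}_{J_{\mathcal{K}_n}}(J_G)=\min\{|B| : B\in\mathcal{D}_c(G)\}=\gamma_c(G).$$
   Context: $[n]=\{1,\dots,n\}$, and $\mathcal{K}_n$ is the complete graph on $[n]$. Graphs are finite and simple (no loops, no multiple edges); $V(G)$ and $E(G)$ denote the vertex and edge sets. Binomial edge ideal: for a graph $G$ on $[n]$, $J_G=(f_{ij}:=x_iy_j-x_jy_i \mid \{i,j\}\in E(G),\ i<j)\subseteq S$, where $S$ has the standard grading (all variables of degree 1). In particular $J_{\mathcal{K}_n}$ is the ideal of $2$-minors of the generic $2\times n$ matrix with rows $(x_1,\dots,x_n)$ and $(y_1,\dots,y_n)$. When $G$ is connected, $J_{\mathcal{K}_n}$ is a minimal prime of $J_G$. Localized v-number: for a homogeneous ideal $I$ of a standard graded polynomial ring $S=\bigoplus_{d\ge 0}S_d$ and an associated prime $\mathfrak{p}\in\operatorname{Ass}(I)$ (i.e. an associated prime of $S/I$), $\mathrm{v}_{\mathfrak{p}}(I):=\min\{d\ge 0\mid \exists f\in S_d \text{ with } (I:f)=\mathfrak{p}\}$. Connected domination: a connected dominating set of a connected graph $G$ is a subset $D\subseteq V(G)$ such that the induced subgraph $G_D$ is connected and every vertex of $V(G)\setminus D$ is adjacent to at least one vertex of $D$. The connected domination number $\gamma_c(G)$ is the minimum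 cardinality of a connected dominating set of $G$. $\mathcal{D}_c(G)$ is the family of all $B\subseteq[n]$ such that for every pair of distinct vertices $i,j$ with $\{i,j\}\notin E(G)$ there exists a path $i,i_1,\dots,i_s,j$ in $G$ with $\{i_1,\dots,i_s\}\subseteq B$. *)

(* Defs.v *)
From mathcomp Require Import all_boot all_order all_algebra.
From mathcomp Require Import mpoly.

Set Implicit Arguments.
Unset Strict Implicit.
Unset Printing Implicit Defensive.

Import GRing.Theory.
Local Open Scope ring_scope.

(* Minima are relational, so that "the minimum is m" includes its existence. *)
Definition is_min (P : nat -> Prop) (m : nat) : Prop :=
  P m /\ forall k, P k -> (m <= k)%N.

(* Ideals are Prop-valued predicates, compared extensionally: membership in a
   generated ideal or in a colon ideal is not given as a boolean predicate,
   which rules out the library's idealr structures. *)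
Section Ideals.
Variable R : comNzRingType.
Implicit Types (I p X : R -> Prop) (f g : R).

Definition is_ideal I : Prop :=
  [/\ I 0, (forall f g, I f -> I g -> I (f + g))
    & (forall f g, I g -> I (f * g))].

Definition is_prime_ideal p : Prop :=
  [/\ is_ideal p, ~ p 1 & forall f g, p (f * g) -> p f \/ p g].

Definition ideal_gen X f : Prop :=
  exists s : seq (R * R),
    (forall c, c \in s -> X c.2) /\ f = \sum_(c <- s) c.1 * c.2.

Definition colon I f : R -> Prop := fun g => I (g * f).

Definition ideal_eq I p : Prop := forall g, I g <-> p g.

(* The annihilator of the class of f in R / I is (I : f). *)
Definition is_associated_prime I p : Prop :=
  is_prime_ideal p /\ exists f, ideal_eq (colon I f) p.

End Ideals.

(* v_p(I) = d; only meaningful for p in Ass(I), which is part of the relation. *)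
Definition is_v_number (K : fieldType) (m : nat)
    (I p : {mpoly K[m]} -> Prop) (d : nat) : Prop :=
  is_associated_prime I p /\
  is_min (fun k => exists f : {mpoly K[m]},
                     f \is k.-homog /\ ideal_eq (colon I f) p) d.

Section Graphs.
Variable n : nat.
Implicit Types (e : rel 'I_n) (B D : {set 'I_n}).

Definition simple_graph e : Prop := ssrbool.symmetric e /\ irreflexive e.

Definition connected_graph e : Prop := forall i j, connect e i j.

Definition complete_graph : rel 'I_n := fun i j => i != j.

Definition induced e D : rel 'I_n :=
  fun i j => [&& i \in D, j \in D & e i j].

Definition connected_dominating_set e D : Prop :=
  (forall i j, i \in D -> j \in D -> connect (induced e D) i j) /\
  (forall i, i \notin D -> exists2 j, j \in D & e i j).

Definition is_connected_domination_number e : nat -> Prop :=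
  is_min (fun k => exists2 D, connected_dominating_set e D & #|D| = k).

Definition Dc e B : Prop :=
  forall i j, i != j -> ~~ e i j ->
    exists s : seq 'I_n,
      [/\ path e i (rcons s j), uniq (i :: rcons s j) & {subset s <= B}].

End Graphs.

(* K[x_1..x_n, y_1..y_n] is {mpoly K[n + n]}, with the x's listed first. *)
Section BinomialEdgeIdeal.
Variables (K : fieldType) (n : nat).

Definition xvar (i : 'I_n) : {mpoly K[n + n]} := 'X_(lshift n i).
Definition yvar (i : 'I_n) : {mpoly K[n + n]} := 'X_(rshift n i).

Definition edge_binomial (i j : 'I_n) : {mpoly K[n + n]} :=
  xvar i * yvar j - xvar j * yvar i.

Definition binomial_edge_ideal (e : rel 'I_n) : {mpoly K[n + n]} -> Prop :=
  ideal_gen (fun f => exists i j : 'I_n,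
                        [/\ e i j, (i < j)%N & f = edge_binomial i j]).

End BinomialEdgeIdeal.

(* Main.v *)
(** For connected noncomplete [G], the members of [Dc] are exactly the connected
    dominating sets. The map [x_v -> t_v], [y_v -> s t_v] has kernel [J_Kn], so
    that [J_Kn] is prime. If [B] lies in [Dc], the identity
    [x_k f_ij = x_i f_kj + x_j f_ik], applied along the paths through [B], shows
    that the product of the [x_v], [v] in [B], has colon ideal [J_Kn].
    Conversely, if [f] has colon ideal [J_Kn], then its image under the map is
    nonzero; let [B] be the set of the [t_v] occurring in one of its monomials,
    so that [#|B| <= deg f]. Were a nonedge [ij] not joined through [B], one
    could set the columns outside of [B + i + j] to zero and use two
    independent parameters [s], [s'] in place of [s]: this kills [J_G] but not
    [f_ij], hence kills [f], against the choice of the monomial. *)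
Require Import Defs.
From mathcomp Require Import all_boot all_order all_algebra.
From mathcomp Require Import mpoly ring zify.

Set Implicit Arguments.
Unset Strict Implicit.
Unset Printing Implicit Defensive.

Import GRing.Theory.
Local Open Scope ring_scope.

(** * Generated ideals and kernels *)

Section Ideals.
Variable R : comNzRingType.
Implicit Types (I X : R -> Prop) (f g : R).

Lemma ideal_opp I f : is_ideal I -> I f -> I (- f).
Proof. by case=> _ _ IM If; rewrite -mulN1r; exact: IM. Qed.

Lemma ideal_gen_is_ideal X : is_ideal (ideal_gen X).
Proof.
split; first by exists [::]; rewrite big_nil.
- move=> f g [s [sX ->]] [s' [s'X ->]]; exists (s ++ s'); rewrite big_cat.
  by split=> // c; rewrite mem_cat => /orP[/sX|/s'X].
- move=> f g [s [sX ->]]; exists [seq (f * c.1, c.2) | c <- s]; split.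
    by move=> _ /mapP[c /sX cX ->].
  by rewrite big_map mulr_sumr; apply: eq_bigr => c _; rewrite mulrA.
Qed.

Lemma mem_ideal_gen X f : X f -> ideal_gen X f.
Proof.
move=> Xf; exists [:: (1, f)]; rewrite big_seq1 mul1r; split=> // c.
by rewrite inE => /eqP ->.
Qed.

Lemma ideal_gen_sub X I : is_ideal I -> (forall f, X f -> I f) ->
  forall f, ideal_gen X f -> I f.
Proof.
move=> [I0 ID IM] XI _ [s [sX ->]]; elim: s sX => [|c s IHs] sX.
  by rewrite big_nil.
rewrite big_cons; apply: ID; first by apply/IM/XI/sX/mem_head.
by apply: IHs => d ds; apply: sX; rewrite inE ds orbT.
Qed.

Lemma kernel_is_ideal (S : nzRingType) (phi : {rmorphism R -> S}) :
  is_ideal (fun f => phi f = 0).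
Proof.
split; first exact: rmorph0.
- by move=> f g; rewrite rmorphD => -> ->; rewrite addr0.
- by move=> f g; rewrite rmorphM => ->; rewrite mulr0.
Qed.

End Ideals.

(** * Connected dominating sets and the family [Dc] *)

Section Domination.
Variables (n : nat) (e : rel 'I_n).
Hypotheses (he : simple_graph e) (hconn : connected_graph e)
           (hne : ~ (e =2 @complete_graph n)).
Implicit Types B D : {set 'I_n}.

Lemma noncomplete_nonedge : exists i j, i != j /\ ~~ e i j.
Proof.
have [sym irr] := he.
case: (boolP [exists i, exists j, (i != j) && ~~ e i j]) => [|nex].
  by move=> /existsP[i /existsP[j /andP[ij neij]]]; exists i, j.
case: hne => i j; rewrite /complete_graph; case: eqVneq => [->|ij] //=.
move/existsPn: nex => /(_ i) /existsPn /(_ j).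
by rewrite ij /= negbK.
Qed.

Lemma path_induced D i s : path (induced e D) i s ->
  path e i s /\ {subset s <= D}.
Proof.
elim: s i => [|k s IHs] i //= /andP[/and3P[_ kD ik] /IHs[-> sD]].
by rewrite ik; split=> // v; rewrite inE => /orP[/eqP->|/sD].
Qed.

Lemma induced_path D i s : i \in D -> {subset s <= D} -> path e i s ->
  path (induced e D) i s.
Proof.
elim: s i => [|k s IHs] i //= iD sD /andP[ik eks].
have kD : k \in D by apply: sD; rewrite mem_head.
by rewrite /induced iD kD ik IHs // => v vs; apply: sD; rewrite inE vs orbT.
Qed.

(** Shortening a connecting path makes its vertices distinct, so the inner ones avoid both [i] and
    [j] and must lie in [B]. *)
Lemma induced_connect_path B i j :
  i != j -> connect (induced e (B :|: [set i; j])) i j ->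
  exists s : seq 'I_n,
    [/\ path e i (rcons s j), uniq (i :: rcons s j) & {subset s <= B}].
Proof.
move=> ij /connectP[p ep jE].
move: ep jE; case/shortenP => p' ep' Up' _ jE.
case/lastP: p' => [|s k] in ep' Up' jE *; first by rewrite jE eqxx in ij.
rewrite last_rcons in jE; rewrite -{k}jE in ep' Up'.
exists s; have [-> sU] := path_induced ep'; split=> // v vs.
have := sU v; rewrite mem_rcons inE vs orbT => /(_ isT).
rewrite !inE => /orP[//|/orP[] /eqP vE]; move: Up' vs; rewrite vE /=.
  by rewrite mem_rcons inE negb_or => /andP[/andP[_ /negPf ->]].
by rewrite rcons_uniq => /andP[_ /andP[/negPf ->]].
Qed.

(** The first inner vertex of a path from [i] to a non-neighbour is a neighbour of [i] in [B]. A
    vertex with no non-neighbour is dominated by any element of [B], and a nonedge of the graph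
    supplies one. *)
Lemma Dc_connected_dominating B : Dc e B -> connected_dominating_set e B.
Proof.
have [sym irr] := he; move=> DcB.
have Dc1 i j : i != j -> ~~ e i j -> exists2 k, k \in B & e i k.
  move=> ij neij; have [[|k s] [/= p _ sB]] := DcB i j ij neij.
    by rewrite andbT (negPf neij) in p.
  by exists k; [apply: sB; rewrite mem_head | case/andP: p].
split=> [i j iB jB|i iNB].
  have [->|ij] := eqVneq i j; first exact: connect0.
  have [eij|neij] := boolP (e i j).
    by apply: connect1; rewrite /induced iB jB.
  have [s [p _ sB]] := DcB i j ij neij; apply/connectP.
  exists (rcons s j); last by rewrite last_rcons.
  apply: induced_path => // v; rewrite mem_rcons inE.
  by move=> /orP[/eqP->|/sB].
have [/existsP[j /andP[ij neij]]|Ni] := boolP [exists j, (i != j) && ~~ e i j].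
  exact: (Dc1 i j).
have [a [b [ab neab]]] := noncomplete_nonedge.
have [k kB _] := Dc1 a b ab neab; exists k => //.
move/existsPn: Ni => /(_ k); rewrite negb_and !negbK => /orP[/eqP ik|//].
by rewrite ik kB in iNB.
Qed.

(** Both endpoints lie in [D] or have a neighbour there, and [D] is connected, so they are joined
    within [D] together with [i] and [j]. *)
Lemma connected_dominating_Dc D : connected_dominating_set e D -> Dc e D.
Proof.
have [sym irr] := he; move=> [Dconn Ddom] i j ij _.
apply: induced_connect_path => //; set U := D :|: _.
have subU : subrel (connect (induced e D)) (connect (induced e U)).
  apply: connect_sub => u v /and3P[uD vD uv]; apply: connect1.
  by rewrite /induced !inE uD vD uv.
have symU : ssrbool.symmetric (induced e U).
  by move=> u v; rewrite /induced sym andbCA.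
have toD v : v \in U -> exists2 d, d \in D & connect (induced e U) v d.
  move=> vU; have [vD|vND] := boolP (v \in D); first by exists v.
  have [d dD vd] := Ddom v vND; exists d => //; apply: connect1.
  by rewrite /induced vU vd !inE dD.
have [|a aD ia] := toD i; first by rewrite !inE eqxx orbT.
have [|b bD jb] := toD j; first by rewrite !inE eqxx !orbT.
apply: connect_trans ia (connect_trans (subU _ _ (Dconn a b aD bD)) _).
by rewrite (sym_connect_sym symU).
Qed.

Lemma connected_dominating_setT : connected_dominating_set e setT.
Proof.
split=> [i j _ _|i]; last by rewrite inE.
apply: connect_sub (hconn i j) => u v uv; apply: connect1.
by rewrite /induced !inE.
Qed.

Lemma connected_domination_number_exists :
  exists m, is_connected_domination_number e m.
Proof.
pose cds D := [forall i in D, forall j in D, connect (induced e D) i j]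
  && [forall (i | i \notin D), exists j in D, e i j].
have cdsP D : reflect (connected_dominating_set e D) (cds D).
  apply: (iffP andP) => -[]; last first.
    move=> Dc Dd; split.
      by apply/forall_inP => i iD; apply/forall_inP => j; exact: Dc.
    by apply/forall_inP => i /Dd[j jD ij]; apply/exists_inP; exists j.
  move=> /forall_inP Dc /forall_inP Dd; split.
    by move=> i j iD jD; apply: (forall_inP (Dc i iD)).
  by move=> i /Dd /exists_inP[j jD ij]; exists j.
have cdsT : cds setT by apply/cdsP/connected_dominating_setT.
have [D /cdsP DD minD] := arg_minnP (fun D : {set 'I_n} => #|D|) cdsT.
exists #|D|; split; first by exists D.
by move=> _ [D' /cdsP D'D <-]; exact: minD.
Qed.

End Domination.

(** * Evaluations with proportional rows and the rank-one parametrisation *)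

Section ScaledEval.
Variables (K : fieldType) (n : nat).

(** Column [v] gets its own ratio [c v], so a minor dies once its two ratios agree or one of its
    columns is zero. The target ring is left general to allow one or two parameters. *)
Definition scaled_eval (S : comNzRingType) (iota : {rmorphism K -> S})
    (u c : 'I_n -> S) : {rmorphism {mpoly K[n + n]} -> S} :=
  GRing.RMorphism.clone _ _ (mmap iota (fun k : 'I_(n + n) =>
    match split k with inl v => u v | inr v => c v * u v end)) _.

Section Eval.
Variables (S : comNzRingType) (iota : {rmorphism K -> S}) (u c : 'I_n -> S).

Lemma scaled_eval_xvar i : scaled_eval iota u c (xvar K i) = u i.
Proof. by rewrite /= mmapX mmap1U (unsplitK (inl i)). Qed.

Lemma scaled_eval_yvar i : scaled_eval iota u c (yvar K i) = c i * u i.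
Proof. by rewrite /= mmapX mmap1U (unsplitK (inr i)). Qed.

Lemma scaled_eval_edge i j :
  scaled_eval iota u c (edge_binomial K i j) = u i * u j * (c j - c i).
Proof.
rewrite rmorphB !rmorphM !scaled_eval_xvar !scaled_eval_yvar; ring.
Qed.

Lemma scaled_eval_ideal0 (e : rel 'I_n) :
  (forall i j, e i j -> u i * u j * (c j - c i) = 0) ->
  forall f, binomial_edge_ideal e f -> scaled_eval iota u c f = 0.
Proof.
move=> ec; apply: ideal_gen_sub; first exact: kernel_is_ideal.
by move=> _ [i [j [eij _ ->]]]; rewrite scaled_eval_edge ec.
Qed.

Lemma scaled_eval_mpolyX m : scaled_eval iota u c 'X_[m] =
  (\prod_v u v ^+ (m (lshift n v) + m (rshift n v)))
  * \prod_v c v ^+ m (rshift n v).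
Proof.
rewrite /= mmapX /mmap1 big_split_ord /= -!big_split /=.
apply: eq_bigr => v _; rewrite (unsplitK (inl v)) (unsplitK (inr v)) exprMn.
by rewrite exprD -mulrA [_ * c v ^+ _]mulrC.
Qed.

Lemma scaled_eval_comp (T : comNzRingType) (g : {rmorphism S -> T})
    (iota' : {rmorphism K -> T}) (u' c' : 'I_n -> T) :
  (forall a, g (iota a) = iota' a) -> (forall v, g (u v) = u' v) ->
  (forall v, g (c v) = c' v) ->
  forall f, g (scaled_eval iota u c f) = scaled_eval iota' u' c' f.
Proof.
move=> gi gu gc f; rewrite /= /mmap rmorph_sum /=; apply: eq_bigr => m _.
rewrite rmorphM gi /mmap1 rmorph_prod; congr (_ * _).
apply: eq_bigr => k _; rewrite rmorphXn /=; congr (_ ^+ _).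
by case: split => v; rewrite ?rmorphM ?gu ?gc.
Qed.

End Eval.

(** The fine degree in which [x_v] and [y_v] both have degree [U_(v)]. With [ydeg] it gives the
    exponents of [t] and [s] in the image of a monomial. *)
Definition indexdeg (m : 'X_{1..n + n}) : 'X_{1..n} :=
  [multinom m (lshift n v) + m (rshift n v) | v < n]%N.

Definition ydeg (m : 'X_{1..n + n}) : nat := \sum_(v < n) m (rshift n v).

Lemma mdeg_indexdeg m : mdeg (indexdeg m) = mdeg m.
Proof.
rewrite !mdegE big_split_ord /= -big_split /=.
by apply: eq_bigr => v _; rewrite mnmE.
Qed.

(* The parametrisation [x_v = t_v], [y_v = s t_v] of the matrices of rank at
   most one, with the columns outside of [U] set to zero. *)
Definition rank_one (U : {set 'I_n}) :
    {rmorphism {mpoly K[n + n]} -> {poly {mpoly K[n]}}} :=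
  scaled_eval (GRing.RMorphism.clone _ _ (polyC \o @mpolyC n K) _)
    (fun v => if v \in U then ('X_v)%:P else 0) (fun=> 'X).

Lemma rank_one_mpolyX (U : {set 'I_n}) m : rank_one U 'X_[m] =
  if [forall (v | v \notin U), indexdeg m v == 0%N]
  then ('X_[indexdeg m])%:P * 'X^(ydeg m) else 0.
Proof.
have -> : rank_one U 'X_[m] =
    (\prod_v (if v \in U then ('X_v)%:P else 0) ^+ indexdeg m v) * 'X^(ydeg m).
  rewrite scaled_eval_mpolyX -expr_sum; congr (_ * _).
  by apply: eq_bigr => v _; rewrite mnmE.
case: forall_inP => [mU|/forall_inP].
  congr (_ * _); rewrite mpolyXE_id rmorph_prod; apply: eq_bigr => v _ /=.
  by rewrite polyC_exp; case: ifPn => [_|/mU/eqP ->]; rewrite ?expr0.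
rewrite negb_forall_in => /exists_inP[v vU mv].
by rewrite (bigD1 v) //= (negPf vU) expr0n (negPf mv) !mul0r.
Qed.

(** The right-hand side does not mention [U]: for [g] supported in [U], restricting the columns to
    [U] leaves this coefficient unchanged. *)
Lemma rank_one_coef (U : {set 'I_n}) r (g : 'X_{1..n}) f :
  (forall v, v \notin U -> g v = 0%N) ->
  (rank_one U f)`_r@_g =
    \sum_(m <- msupp f | (indexdeg m == g) && (ydeg m == r)) f@_m.
Proof.
move=> gU; rewrite {1}[f]mpolyE rmorph_sum coef_sum raddf_sum [RHS]big_mkcond.
apply: eq_bigr => m _; rewrite -mul_mpolyC rmorphM.
have -> : rank_one U (f@_m)%:MP = (f@_m)%:MP%:P by rewrite /= mmapC.
rewrite coefCM -[LHS]/(mcoeff g _) mcoeffCM rank_one_mpolyX.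
case: (boolP ((indexdeg m == g) && _)) => [/andP[/eqP mg /eqP mr]|Nm].
  rewrite mg mr; have -> : [forall (v | v \notin U), g v == 0%N].
    by apply/forall_inP => v /gU ->.
  by rewrite coefCM coefXn eqxx mulr1 mcoeffX eqxx mulr1.
case: ifP => _; last by rewrite coef0 mcoeff0 mulr0.
rewrite coefCM coefXn eq_sym; case: (eqVneq (ydeg m) r) Nm => [_|_ _].
  by rewrite andbT mulr1 mcoeffX => /negPf ->; rewrite mulr0.
by rewrite mulr0 mcoeff0 mulr0.
Qed.

(** * The kernel of the parametrisation and primality of the ideal of the complete graph *)

Lemma rank_one_complete_ideal f :
  binomial_edge_ideal (@complete_graph n) f -> rank_one setT f = 0.
Proof. by apply: scaled_eval_ideal0 => i j _; rewrite subrr mulr0. Qed.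

Lemma mem_binomial_edge_ideal (e : rel 'I_n) i j :
  simple_graph e -> e i j -> binomial_edge_ideal e (edge_binomial K i j).
Proof.
move=> [sym irr] eij; have [ij|ji|/val_inj ij] := ltngtP i j.
- by apply: mem_ideal_gen; exists i, j.
- have -> : edge_binomial K i j = - edge_binomial K j i by rewrite opprB.
  apply: ideal_opp; first exact: ideal_gen_is_ideal.
  by apply: mem_ideal_gen; exists j, i; rewrite sym.
- by rewrite ij irr in eij.
Qed.

Lemma complete_graph_simple : simple_graph (@complete_graph n).
Proof.
by split=> [i j|i]; rewrite /complete_graph ?eqxx // eq_sym.
Qed.

Lemma indexdegD m1 m2 : indexdeg (m1 + m2) = (indexdeg m1 + indexdeg m2)%MM.
Proof. by apply/mnmP => v; rewrite mnmDE !mnmE addnACA. Qed.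

Lemma indexdeg_xvar i : indexdeg U_(lshift n i) = U_(i)%MM.
Proof.
by apply/mnmP => v; rewrite mnmE !mnm1E eq_lshift eq_lrshift addn0.
Qed.

Lemma indexdeg_yvar i : indexdeg U_(rshift n i) = U_(i)%MM.
Proof. by apply/mnmP => v; rewrite mnmE !mnm1E eq_rshift eq_rlshift. Qed.

Lemma ydegD m1 m2 : ydeg (m1 + m2) = (ydeg m1 + ydeg m2)%N.
Proof.
by rewrite /ydeg -big_split; apply: eq_bigr => v _; rewrite mnmDE.
Qed.

Lemma ydeg_xvar i : ydeg U_(lshift n i) = 0%N.
Proof. by rewrite /ydeg big1 // => v _; rewrite mnm1E eq_lrshift. Qed.

Lemma ydeg_yvar i : ydeg U_(rshift n i) = 1%N.
Proof.
rewrite /ydeg (bigD1 i) //= mnm1E eqxx big1 // => v vi.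
by rewrite mnm1E eq_rshift eq_sym (negPf vi).
Qed.

Lemma sum_eq_leq (b b' : 'I_n -> nat) :
  (\sum_v b v = \sum_v b' v)%N -> (forall v, b v <= b' v)%N -> b =1 b'.
Proof.
move=> sbb' bb' v; apply/eqP; rewrite eqn_leq bb' /= -subn_eq0.
have : (\sum_w (b' w - b w) == 0)%N by rewrite sumnB // sbb' subnn.
by rewrite sum_nat_eq0 => /forall_inP ->.
Qed.

(* While two monomials of equal degrees differ, some [x_j y_i] dividing the
   first can be traded for [x_i y_j], bringing it closer to the second. *)
Lemma mpolyX_sub_mem m m' : indexdeg m = indexdeg m' -> ydeg m = ydeg m' ->
  binomial_edge_ideal (@complete_graph n) ('X_[m] - 'X_[m'] : {mpoly K[n + n]}).
Proof.
pose J := @binomial_edge_ideal K n (@complete_graph n).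
have [J0 JD JM] : is_ideal J by exact: ideal_gen_is_ideal.
pose b (m : 'X_{1..n + n}) v := m (rshift n v).
(* Subtraction is truncated, so the induction measure is the total excess of the [y]-exponents of
   [m] over those of [m']. *)
have [k] := ubnP (\sum_v (b m v - b m' v))%N.
elim: k m => // k IHk m; rewrite ltnS => dk mm' ymm'.
have [/existsP[i bi]|Ni] := boolP [exists i, b m' i < b m i]%N; last first.
  have bb : b m =1 b m'.
    apply: sum_eq_leq => // v; rewrite leqNgt.
    by move/existsPn: Ni => /(_ v).
  suff -> : m = m' by rewrite subrr.
  apply/mnmP => l; case: (split_ordP l) => v ->; last exact: bb.
  move/mnmP: mm' => /(_ v); rewrite !mnmE -!/(b _ v) bb.
  by move/addIn.
have [/existsP[j bj]|Nj] := boolP [exists j, b m j < b m' j]%N; last first.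
  have := @sum_eq_leq (b m') (b m) (esym ymm') _ i.
  move=> bb; rewrite bb ?ltnn // in bi.
  by move=> v; rewrite leqNgt; move/existsPn: Nj => /(_ v).
have ij : i != j by apply: contraTneq bi => ->; rewrite -leqNgt ltnW.
pose m0 := (m - (U_(lshift n j) + U_(rshift n i)))%MM.
(* The variable [x_j] divides [m]: both monomials have the same total exponent in column [j], and
   [m] has fewer [y_j]. *)
have mE : m = (m0 + (U_(lshift n j) + U_(rshift n i)))%MM.
  rewrite submK //; apply/mnm_lepP => l; rewrite mnmDE !mnm1E.
  case: (split_ordP l) => v ->; rewrite ?eq_lshift ?eq_rshift ?eq_lrshift ?eq_rlshift.
    rewrite addn0; case: eqP => // <-; move/mnmP: mm' => /(_ j).
    by rewrite !mnmE; move: bj; rewrite /b; lia.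
  by case: eqP => // <-; move: bi; rewrite /b; lia.
pose m1 := (m0 + (U_(lshift n i) + U_(rshift n j)))%MM.
rewrite -(subrK 'X_[m1] 'X_[m]) -addrA; apply: JD.
  have -> : 'X_[m] - 'X_[m1] = 'X_[m0] * edge_binomial K j i.
    by rewrite {1}mE /m1 !mpolyXD /edge_binomial /xvar /yvar; ring.
  apply: JM; apply: mem_binomial_edge_ideal; first exact: complete_graph_simple.
  by rewrite /complete_graph eq_sym.
apply: IHk; last 2 first.
- rewrite -mm' mE /m1 !indexdegD !indexdeg_xvar !indexdeg_yvar.
  by rewrite [(U_(j) + _)%MM]addmC.
- by rewrite -ymm' mE /m1 !ydegD !ydeg_xvar !ydeg_yvar.
apply: leq_trans dk.
have bm v : b m v = (b m0 v + (i == v))%N.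
  by rewrite /b {1}mE !mnmDE !mnm1E eq_lrshift eq_rshift.
have bm1 v : b m1 v = (b m0 v + (j == v))%N.
  by rewrite /b !mnmDE !mnm1E eq_lrshift eq_rshift.
(* The trade lowers the excess at [i] by one, while at [j] it stays zero since [m] had strictly
   fewer [y_j] than [m']. *)
rewrite [ltnRHS](bigD1 i) // [ltnLHS](bigD1 i) //=.
rewrite -addSn; apply: leq_add.
  by move: bi; rewrite bm bm1 eqxx [j == i]eq_sym (negPf ij); lia.
apply: leq_sum => v vi; rewrite bm bm1 [i == v]eq_sym (negPf vi).
by case: eqP => [<-|_]; move: bj; rewrite ?bm ?(negPf ij); lia.
Qed.

(** Induction on the size of the support. The coefficient of the image at the degrees of [m]
    vanishes, so another monomial [m'] of [f] has the same degrees. Subtracting a multiple of the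
    binomial ['X_[m] - 'X_[m']] removes [m] and adds no monomial. *)
Lemma kernel_rank_one f : rank_one setT f = 0 ->
  binomial_edge_ideal (@complete_graph n) f.
Proof.
pose J := @binomial_edge_ideal K n (@complete_graph n).
have [J0 JD JM] : is_ideal J by exact: ideal_gen_is_ideal.
have [k] := ubnP (size (msupp f)); elim: k f => // k IHk f; rewrite ltnS => fk f0.
have [->//|] := eqVneq f 0; rewrite -msupp_eq0.
case fE : (msupp f) => [|m s] // _.
have mf : m \in msupp f by rewrite fE mem_head.
have [/hasP[m' m's /andP[/eqP mm' /eqP ymm']]|Nm] :=
    boolP (has (fun m' => (indexdeg m' == indexdeg m) && (ydeg m' == ydeg m)) s);
  last first.
  have := @rank_one_coef setT (ydeg m) (indexdeg m) f.
  rewrite f0 coef0 mcoeff0 fE big_cons !eqxx /= big_hasC // addr0.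
  move=> /(_ _)/esym/eqP; rewrite mcoeff_eq0 mf => /(_ _) H.
  by suff: false by []; apply: H => v; rewrite inE.
have Jm : J ('X_[m] - 'X_[m']) by exact: mpolyX_sub_mem.
pose h := f - f@_m *: ('X_[m] - 'X_[m']).
have -> : f = h + f@_m *: ('X_[m] - 'X_[m']) by rewrite /h subrK.
apply: JD; last by rewrite -mul_mpolyC; apply: JM.
apply: IHk; last first.
  rewrite /h rmorphB f0 -mul_mpolyC rmorphM (rank_one_complete_ideal Jm).
  by rewrite mulr0 subr0.
apply: leq_trans fk; rewrite fE /= ltnS.
apply: uniq_leq_size => // l; rewrite mcoeff_msupp.
have ms : m \notin s by have := msupp_uniq f; rewrite fE => /andP[].
rewrite /h mcoeffB mcoeffZ mcoeffB !mcoeffX.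
have [<-|ml] := eqVneq m l.
  have -> : m' == m = false by apply: contraNF ms => /eqP <-.
  by rewrite subr0 mulr1 subrr eqxx.
have [<-//|m'l] := eqVneq m' l.
rewrite subrr mulr0 subr0 -mcoeff_msupp fE inE eq_sym.
by rewrite (negPf ml).
Qed.

(** It is the kernel of [rank_one setT], whose target is an integral domain. *)
Lemma complete_ideal_is_prime :
  is_prime_ideal (@binomial_edge_ideal K n (@complete_graph n)).
Proof.
split; first exact: ideal_gen_is_ideal.
  by move/rank_one_complete_ideal/eqP; rewrite rmorph1 oner_eq0.
move=> f g /rank_one_complete_ideal/eqP; rewrite rmorphM mulf_eq0.
by case/orP => /eqP /kernel_rank_one; [left | right].
Qed.

End ScaledEval.

(** * Colon ideals of [Je] equal to [JK], and the sets in [Dc] *)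

Section ColonIdeal.
Variables (K : fieldType) (n : nat) (e : rel 'I_n).
Hypothesis he : simple_graph e.
Local Notation Je := (@binomial_edge_ideal K n e).
Local Notation JK := (@binomial_edge_ideal K n (@complete_graph n)).

Lemma binomial_edge_ideal_sub f : Je f -> JK f.
Proof.
apply: ideal_gen_sub; first exact: ideal_gen_is_ideal.
move=> _ [i [j [_ ij ->]]]; apply: mem_ideal_gen; exists i, j; split=> //.
by rewrite /complete_graph neq_ltn ij.
Qed.

Lemma path_product_mem i s j : path e i (rcons s j) ->
  Je ((\prod_(v <- s) xvar K v) * edge_binomial K i j).
Proof.
have [J0 JD JM] : is_ideal Je by exact: ideal_gen_is_ideal.
elim: s i => [|k s IHs] i /=.
  by rewrite andbT big_nil mul1r; exact: mem_binomial_edge_ideal.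
move=> /andP[eik /IHs Jkj]; rewrite big_cons.
set P := \prod_(v <- s) _ in Jkj *.
have -> : xvar K k * P * edge_binomial K i j =
    xvar K i * (P * edge_binomial K k j)
    + xvar K j * P * edge_binomial K i k.
  by rewrite /edge_binomial; ring.
by apply: JD; apply: JM => //; exact: mem_binomial_edge_ideal.
Qed.

(** Its image under the parametrisation is a product of variables [t_v], hence nonzero. *)
Lemma prod_xvar_notin (B : {set 'I_n}) : ~ JK (\prod_(v in B) xvar K v).
Proof.
move/rank_one_complete_ideal/eqP; rewrite rmorph_prod; apply/negP.
apply/prodf_neq0 => v _; rewrite scaled_eval_xvar inE polyC_eq0.
by rewrite -msupp_eq0 msuppX.
Qed.

Lemma prod_xvar_homog (B : {set 'I_n}) :
  \prod_(v in B) xvar K v \is #|B|.-homog.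
Proof.
rewrite -sum1_card /xvar; elim/big_rec2: _ => [|v p k _ ph].
  exact: dhomog1.
by apply: dhomogM => //; rewrite dhomogX /= mdeg1.
Qed.

(** One inclusion is primality of [JK]. For the other, a path through [B] handles each nonedge, the
    remaining factors of the product being harmless. *)
Lemma colon_prod_xvar (B : {set 'I_n}) : Dc e B ->
  ideal_eq (colon Je (\prod_(v in B) xvar K v)) JK.
Proof.
have [J0 JD JM] : is_ideal Je by exact: ideal_gen_is_ideal.
move=> DcB g; split; rewrite /colon.
  move/binomial_edge_ideal_sub.
  by have [_ _ pK] := complete_ideal_is_prime K n; case/pK => // /prod_xvar_notin.
move: g; apply: ideal_gen_sub.
  split; first by rewrite mul0r.
    by move=> f g Jf Jg; rewrite mulrDl; exact: JD.
  by move=> f g Jg; rewrite -mulrA; exact: JM.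
move=> _ [i [j [ij _ ->]]].
have [eij|neij] := boolP (e i j).
  by rewrite mulrC; apply/JM/mem_binomial_edge_ideal.
have [s [p Us sB]] := DcB i j ij neij.
rewrite (bigID (mem s)) /=.
have -> : \prod_(v in B | v \in s) xvar K v = \prod_(v <- s) xvar K v.
  rewrite big_uniq; last by move: Us; rewrite /= rcons_uniq => /and3P[].
  by apply: eq_bigl => v; apply/andb_idl/sB.
set P := \prod_(v <- s) _; set Q := \prod_(v in B | _) _.
have -> : edge_binomial K i j * (P * Q) = Q * (P * edge_binomial K i j) by ring.
by apply/JM/path_product_mem.
Qed.

(* If [i] and [j] are not joined within [U], two independent parameters can
   scale the component of [i] in [U] and the rest; this kills [Je] but not the
   binomial of [i] and [j]. *)
Lemma rank_one_disconnected (U : {set 'I_n}) i j f : i \in U -> j \in U ->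
  ~~ connect (induced e U) i j -> Je (edge_binomial K i j * f) ->
  rank_one K U f = 0.
Proof.
have [sym irr] := he; move=> iU jU nij.
pose S := {poly {poly {mpoly K[n]}}}.
pose t (v : 'I_n) : S := (if v \in U then ('X_v)%:P else 0)%:P.
(* The outer variable is the ratio on the component of [i], the inner one on all other columns. *)
pose c (v : 'I_n) : S := if connect (induced e U) i v then 'X else 'X%:P.
pose iota := GRing.RMorphism.clone _ _ (polyC \o (polyC \o @mpolyC n K)) _
  : {rmorphism K -> S}.
have t_neq0 v : v \in U -> t v != 0.
  by move=> vU; rewrite /t vU !polyC_eq0 -msupp_eq0 msuppX.
have eU v w : v \in U -> w \in U -> e v w ->
    connect (induced e U) i v -> connect (induced e U) i w.
  move=> vU wU evw iv; apply: connect_trans iv (connect1 _).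
  by rewrite /induced vU wU.
move/(@scaled_eval_ideal0 K n S iota t c e) => H.
have {H}/eqP : scaled_eval iota t c (edge_binomial K i j * f) = 0.
  apply: H => v w evw; rewrite /t.
  have [vU|_] := boolP (v \in U); last by rewrite polyC0 !mul0r.
  have [wU|_] := boolP (w \in U); last by rewrite polyC0 mulr0 mul0r.
  have -> : c v = c w.
    rewrite /c; congr (if _ then _ else _).
    by apply/idP/idP; apply: eU => //; rewrite sym.
  by rewrite subrr mulr0.
have cij : c j - c i != 0.
  rewrite /c connect0 (negPf nij) subr_eq0; apply/eqP.
  move/(congr1 (fun p : S => p`_1)); rewrite coefC coefX /=.
  by move/eqP; rewrite eq_sym oner_eq0.
rewrite rmorphM scaled_eval_edge !mulf_eq0 (negPf (t_neq0 i iU)).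
rewrite (negPf (t_neq0 j jU)) (negPf cij) => /eqP f0.
(* Evaluating the outer variable at the inner one identifies the two parameters and recovers
   [rank_one]. *)
pose ev : {rmorphism S -> {poly {mpoly K[n]}}} :=
  GRing.RMorphism.clone _ _ (horner_eval 'X) _.
have <- : ev (scaled_eval iota t c f) = rank_one K U f.
  apply: scaled_eval_comp => [a|v|v]; rewrite /= /horner_eval ?hornerC //.
  by rewrite /c; case: ifP => _; rewrite ?hornerX ?hornerC.
by rewrite f0 rmorph0.
Qed.

Lemma homog_colon_Dc k f : connected_graph e -> f \is k.-homog ->
  ideal_eq (colon Je f) JK -> exists2 B : {set 'I_n}, Dc e B & (#|B| <= k)%N.
Proof.
have [sym irr] := he; move=> hconn fh fK.
have [J0 JD JM] : is_ideal Je by exact: ideal_gen_is_ideal.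
have DcT : Dc e setT by exact/connected_dominating_Dc/connected_dominating_setT.
(* If [f] were in [JK], its product with all the [x_v] would lie in [Je]; the product of the [x_v]
   would then be in the colon ideal of [f], which is [JK]. *)
have /eqP f_neq0 : rank_one K setT f <> 0.
  move/kernel_rank_one/(colon_prod_xvar DcT); rewrite /colon mulrC.
  by move/fK/prod_xvar_notin.
have [r [g fg]] : exists r g, (rank_one K setT f)`_r@_g != 0.
  exists (size (rank_one K setT f)).-1, (mlead (lead_coef (rank_one K setT f))).
  by rewrite mleadc_eq0 lead_coef_eq0.
have [m mf mg] : exists2 m, m \in msupp f & indexdeg m = g.
  move: fg; rewrite rank_one_coef; last by move=> v; rewrite inE.
  have [/hasP[m mf /eqP mg] _|Nm] := boolP (has (fun m => indexdeg m == g) (msupp f)).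
    by exists m.
  rewrite big_seq_cond big1 ?eqxx // => m /and3P[mf mg _].
  by move/hasPn: Nm => /(_ m mf); rewrite mg.
pose B := [set v | g v != 0%N]; exists B; last first.
  (* The degree [k] is the sum of the exponents of [g], each at least one on [B]. *)
  rewrite -(dhomog_mf fh mf) /= -mdeg_indexdeg mg mdegE -sum1_card.
  rewrite [leqRHS](bigID (mem B)) /=; apply: leq_trans (leq_addr _ _).
  by apply: leq_sum => v; rewrite inE lt0n.
move=> i j ij neij; apply: induced_connect_path => //; set U := B :|: _.
apply: contraNT fg => nij.
have U0 : rank_one K U f = 0.
  apply: (@rank_one_disconnected U i j) => //; rewrite ?inE ?eqxx ?orbT //.
  by apply/fK/mem_binomial_edge_ideal; first exact: complete_graph_simple.
have gU v : v \notin U -> g v = 0%N.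
  by rewrite !inE !negb_or negbK => /andP[/eqP].
(* Since [g] is supported in [U], its coefficient over all columns equals the one over [U], which is
   zero. *)
rewrite rank_one_coef; last by move=> v; rewrite inE.
by rewrite -(rank_one_coef r f gU) U0 coef0 mcoeff0.
Qed.

End ColonIdeal.

Theorem theorem1 (K : fieldType) (n : nat) (e : rel 'I_n)
    (he : simple_graph e) (hconn : connected_graph e)
    (hne : ~ (e =2 @complete_graph n)) :
  exists m : nat,
    [/\ is_v_number (@binomial_edge_ideal K n e)
                    (@binomial_edge_ideal K n (@complete_graph n)) m,
        is_min (fun k => exists2 B : {set 'I_n}, Dc e B & #|B| = k) m
      & is_connected_domination_number e m].
Proof.
have [m minm] := connected_domination_number_exists hconn.
exists m; have [[D De Dm] leD] := minm.
have DcD : Dc e D by exact: connected_dominating_Dc.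
have leDc B : Dc e B -> (m <= #|B|)%N.
  by move=> DcB; apply: leD; exists B => //; exact: Dc_connected_dominating.
have colonD := colon_prod_xvar (K := K) he DcD.
split=> //; last first.
  by split; [exists D | move=> _ [B DcB <-]; exact: leDc].
split.
  (* The product over a minimum connected dominating set [D] shows that the prime is associated, and
     it also attains degree [m]. *)
  by split; [exact: complete_ideal_is_prime | exists (\prod_(v in D) xvar K v)].
split; first by exists (\prod_(v in D) xvar K v); rewrite -Dm prod_xvar_homog.
move=> k [f [fh fK]]; have [B DcB Bk] := homog_colon_Dc he hconn fh fK.
exact: leq_trans (leDc B DcB) Bk.
Qed.
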